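(* For every $\varepsilon>0$ there exists an integer $N_{\varepsilon}$ such that if $G$ is a tree with $n\geq N_{\varepsilon}$ vertices, then $$\max_{\mathcal{A}}CC(\mathcal{A})\leq\left(\frac{1}{4}+\varepsilon\right)n,$$ where the maximum is over all full information stopping algorithms $\mathcal{A}$ on $G$.
   Context: Let $G$ be a fixed graph with $n$ vertices. Its vertices become active one by one in a uniformly random order (permutation) $\sigma\in S_n$; $\sigma(i)$ denotes the $i$-th vertex to become active. $CC(\sigma,t)$ denotes the number of connected components of the induced subgraph $G[\{\sigma(1),\dots,\sigma(t)\}]$. A full information stopping algorithm on $G$ is a function $\mathcal{A}:S_n\to\{0,1,\dots,n\}$ such that for all $\sigma,\tau\in S_n$: if $\sigma(i)=\tau(i)$ for all $i\le\mathcal{A}(\sigma)$, then $\mathcal{A}(\tau)=\mathcal{A}(\sigma)$. (The algorithm knows $G$ in advance and at each time knows which vertices have become active, but not the order of the future vertices.) Its score is $CC(\mathcal{A})=\frac{1}{n!}\sum_{\sigma\in S_n}CC(\sigma,\mathcal{A}(\sigma))$. *)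

(* Defs.v *)
From HB Require Import structures.
From mathcomp Require Import all_boot all_order all_algebra all_fingroup.
From mathcomp Require Import reals.

Set Implicit Arguments.
Unset Strict Implicit.
Unset Printing Implicit Defensive.

Import Order.TTheory GRing.Theory Num.Theory.
Local Open Scope ring_scope.

(* The vertex set of a graph on n vertices is 'I_n, so that an order of
   activation of the vertices is an element of 'S_n. *)
Record sgraph (n : nat) := SGraph {
  adj :> rel 'I_n;
  adj_sym : symmetric adj;
  adj_irr : irreflexive adj
}.

Definition graph_connected n (G : sgraph n) : Prop :=
  (0 < n)%N /\ forall x y : 'I_n, connect G x y.

Definition graph_acyclic n (G : sgraph n) : Prop :=
  forall c : seq 'I_n, (2 < size c)%N -> ~ ucycle G c.

Definition is_tree n (G : sgraph n) : Prop :=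
  graph_connected G /\ graph_acyclic G.

Definition induced_adj n (G : sgraph n) (A : {set 'I_n}) : rel 'I_n :=
  fun x y => [&& x \in A, y \in A & G x y].

(* Indices start at 0: the (i+1)-st vertex to become active is s i. *)
Definition active n (s : 'S_n) (t : nat) : {set 'I_n} :=
  [set s i | i : 'I_n & (i < t)%N].

(* Vertices outside of the active set are isolated for induced_adj; n_comp
   counts only the components contained in the active set. *)
Definition CC n (G : sgraph n) (s : 'S_n) (t : nat) : nat :=
  n_comp (induced_adj G (active s t)) (active s t).

Definition stopping_algorithm n (A : {ffun 'S_n -> 'I_n.+1}) : bool :=
  [forall s : 'S_n, forall u : 'S_n,
     [forall i : 'I_n, (i < A s)%N ==> (s i == u i)] ==> (A u == A s)].

Definition score (R : realType) n (G : sgraph n) (A : {ffun 'S_n -> 'I_n.+1})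
    : R :=
  (n`!%:R)^-1 * \sum_(s : 'S_n) (CC G s (A s))%:R.

(* The default value 0 of the iterated maximum is harmless, being the score of
   the algorithm that stops at time 0: see max_scoreP. *)
Definition max_score (R : realType) n (G : sgraph n) : R :=
  \big[Num.max/0]_(A : {ffun 'S_n -> 'I_n.+1} | stopping_algorithm A)
    score R G A.

Lemma stopping_algorithmP n (A : {ffun 'S_n -> 'I_n.+1}) :
  reflect (forall s u : 'S_n,
             (forall i : 'I_n, (i < A s)%N -> s i = u i) -> A u = A s)
          (stopping_algorithm A).
Proof.
apply: (iffP 'forall_forallP) => stA s u.
  move=> su; have /implyP/(_ _)/eqP := stA s u; apply.
  by apply/forallP => i; apply/implyP => /su ->.
apply/implyP => /forallP su; apply/eqP/stA => i iA.
by apply/eqP; move: (su i); rewrite iA.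
Qed.

Lemma score_ge0 (R : realType) n (G : sgraph n) A : 0 <= score R G A.
Proof.
by rewrite mulr_ge0 ?invr_ge0 ?ler0n // sumr_ge0 // => s _; rewrite ler0n.
Qed.

Lemma max_scoreP (R : realType) n (G : sgraph n) :
  (exists2 A, stopping_algorithm A & max_score R G = score R G A) /\
  (forall A, stopping_algorithm A -> score R G A <= max_score R G).
Proof.
split; last by move=> A stA; apply: le_bigmax_cond.
have st0 : stopping_algorithm [ffun=> ord0 : 'I_n.+1].
  by apply/stopping_algorithmP => s u _; rewrite !ffunE.
have [A stA eqA] := Order.TotalTheory.eq_bigmax _ _ _ st0
  (fun A _ => score_ge0 R G A).
by exists A.
Qed.

(* Main.v *)
Require Import Defs.
From mathcomp Require Import all_boot all_order all_algebra all_fingroup.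
From mathcomp Require Import reals zify ring lra.

Set Implicit Arguments.
Unset Strict Implicit.
Unset Printing Implicit Defensive.

Import Order.TTheory GRing.Theory Num.Theory.
Local Open Scope ring_scope.

(** In a forest the number of components is the number of vertices minus the
number of edges. Hence, when m = n - t vertices are still inactive,
CC = 1 - m + m M - m (m - 1) U / 2, where M is the average degree of the
inactive vertices and U their edge density. Conditionally on the past of a
stopping time, the future is exchangeable: in expectation M and U may be
replaced by the degree of the last vertex, and by the adjacency of the last
two vertices. Put g(x, y) = (n - 2) [x ~ y] - deg x - deg y + 2, and let Z be
the average of g over the pairs of inactive vertices. Eliminating U gives
CC = 1 + (M - 1) m (n - 1 - m) / (n - 2) - m (m - 1) Z / (2 (n - 2)).
As M >= 1 and E M = 2 (n - 1) / n whatever the stopping time, the first two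
terms contribute at most 1 + n / 4. In a tree, g sums to 0 over each of its
rows, so Z is a degenerate U-statistic, of second moment O(n / m^2): replacing
Z by its value at the fixed time n - m0, with m0 proportional to n, makes the
last term o(n), while stopping later than that time contributes at most
m0^2 / n. *)

(** * Counting edges and components in forests and trees *)

(* Every edge is counted twice, once for each orientation. *)
Definition edges2 n (G : sgraph n) (S : {set 'I_n}) : nat :=
  (\sum_(x in S) \sum_(y in S) G x y)%N.

(** If every vertex of [S] had two neighbours in [S], a path in [S] could be prolonged forever at
    its head: the head has a neighbour other than its successor, and acyclicity makes that neighbour
    a new vertex. A path on more than [n] vertices is absurd. *)
Lemma acyclic_low_degree n (G : sgraph n) (S : {set 'I_n}) :
  graph_acyclic G -> S != set0 ->
  exists2 x, x \in S & (#|[set y in S | G x y]| <= 1)%N.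
Proof.
move=> acG /set0Pn[x0 x0S].
case: (boolP [exists x in S, #|[set y in S | G x y]| <= 1]%N) => [/exists_inP//|].
rewrite negb_exists_in => /forall_inP deg2.
suff longpath k : exists x p,
    [/\ size p = k, path G x p, uniq (x :: p) & {subset x :: p <= S}].
  have [x [p [sz_p _ /card_uniqP/= cxp _]]] := longpath n.
  by have := max_card [in x :: p]; rewrite cxp sz_p card_ord ltnn.
elim: k => [|k [x [p [sz_p Gp Up Sp]]]].
  by exists x0, [::]; split=> // y; rewrite inE => /eqP->.
have xS : x \in S by apply: Sp; rewrite mem_head.
(* When [p] is empty the default [head x p] is [x], whose removal costs nothing, as [x] is not its
   own neighbour. *)
have /card_gt0P[y] : (0 < #|[set y in S | G x y] :\ head x p|)%N.
  have := deg2 _ xS; rewrite -ltnNge (cardsD1 (head x p)).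
  by case: (_ \in _); rewrite ?add0n ?add1n // => /ltnW.
rewrite !inE => /and3P[y_p yS Gxy].
have Gyx : G y x by rewrite adj_sym.
have y_x : y != x by apply: contraTneq Gxy => ->; rewrite adj_irr.
have [yp|ynp] := boolP (y \in p); last first.
  exists y, (x :: p); split=> //=; first by rewrite sz_p.
  - by rewrite Gyx.
  - by rewrite inE (negPf y_x) (negPf ynp).
  - by move=> z; rewrite inE => /predU1P[->|/Sp].
(* If [y] already lies on the path, the segment from [x] to [y] closes into a cycle; it has at least
   three vertices because [y] is not the successor of [x]. *)
case/splitPr: yp y_p Gp Up {sz_p Sp} => p1 p2 y_p Gp Up.
case: p1 y_p Gp Up => [/=|z p1 _ Gp Up]; first by rewrite eqxx.
case: (acG (x :: rcons (z :: p1) y)); first by rewrite /= size_rcons.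
move: Gp Up; rewrite -cat_rcons -cat_cons cat_uniq cat_path.
move=> /andP[Gp _] /and3P[Up _ _].
rewrite /ucycle Up andbT; change (path G x (rcons (rcons (z :: p1) y) x)).
rewrite rcons_path Gp.
by rewrite last_rcons.
Qed.

(** Induction on [S], removing a vertex with at most one neighbour in [S]: an isolated vertex joins
    [R], while a leaf is reached through its neighbour, so that its edge pays for it. The set [R]
    meets every component and has at most vertices minus edges many elements. *)
Lemma forest_transversal n (G : sgraph n) (S : {set 'I_n}) :
  graph_acyclic G ->
  exists R : {set 'I_n},
    (2 * #|R| + edges2 G S <= 2 * #|S|)%N /\
    forall x, x \in S -> exists2 y, y \in R :&: S & connect (induced_adj G S) x y.
Proof.
move=> acG; have [k] := ubnP #|S|; elim: k S => // k IHk S ltSk.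
have [->|S0] := eqVneq S set0.
  exists set0; split; last by move=> x; rewrite inE.
  by rewrite /edges2 big_set0 cards0.
have [x xS degx] := acyclic_low_degree acG S0.
have [|R [cR conR]] := IHk (S :\ x).
  by move: ltSk; rewrite (cardsD1 x) xS.
set dx := #|_| in degx.
have eS : edges2 G S = (2 * dx + edges2 G (S :\ x))%N.
  have sumx y : (\sum_(z in S) G y z = G y x + \sum_(z in S :\ x) G y z)%N.
    by rewrite (big_setD1 x).
  have dxE : (\sum_(z in S :\ x) G x z = dx)%N.
    rewrite /dx -sum1_card big_mkcond [RHS]big_mkcond; apply: eq_bigr => z _.
    rewrite !inE; case: eqP => [->|] /=; rewrite ?adj_irr ?andbF //.
    by case: (z \in S); case: (G x z).
  rewrite /edges2 (big_setD1 x) //= sumx adj_irr dxE.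
  under eq_bigr do rewrite sumx.
  rewrite big_split /=.
  under eq_bigr do rewrite adj_sym.
  by rewrite dxE; lia.
have sub : subrel (connect (induced_adj G (S :\ x))) (connect (induced_adj G S)).
  apply: connect_sub => u v /and3P[]; rewrite !inE => /andP[_ uS] /andP[_ vS] uv.
  by apply: connect1; rewrite /induced_adj uS vS.
have conR' y : y \in S -> y != x ->
    exists2 z, z \in R :&: S & connect (induced_adj G S) y z.
  move=> yS yx; have [|z] := conR y; first by rewrite !inE yx.
  rewrite !inE => /and3P[zR _ zS] /sub yz; exists z => //.
  by rewrite inE zR.
have cS : #|S| = #|S :\ x|.+1 by rewrite (cardsD1 x) xS.
have [dx0|dx0] := posnP dx.
  exists (x |: R); split.
    rewrite eS dx0 cS cardsU1; case: (x \notin R); lia.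
  move=> y yS; have [->|yx] := eqVneq y x.
    by exists x; rewrite ?inE ?eqxx.
  have [z] := conR' y yS yx; rewrite !inE => /andP[zR zS] yz; exists z => //.
  by rewrite !inE zR zS orbT.
exists R; split; first by rewrite eS cS; lia.
move=> y yS; have [->|yx] := eqVneq y x; last exact: conR'.
move: dx0 => /card_gt0P[z]; rewrite inE => /andP[zS xz].
have [|v vR zv] := conR' z zS; first by apply: contraTneq xz => ->; rewrite adj_irr.
exists v => //; apply: connect_trans zv.
by apply: connect1; rewrite /induced_adj xS zS.
Qed.

Lemma n_comp_le_transversal (T : finType) (e : rel T) (S R : {set T}) :
  connect_sym e ->
  (forall x, x \in S -> exists2 y, y \in R :&: S & connect e x y) ->
  (n_comp e S <= #|R|)%N.
Proof.
move=> symE conR; rewrite /n_comp_mem.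
apply: leq_trans (leq_imset_card (fingraph.root e) R).
apply/subset_leq_card/subsetP => r; rewrite !inE => /andP[/eqP rr rS].
have [y] := conR r rS; rewrite inE => /andP[yR _] /(fingraph.rootP symE) ry.
by apply/imsetP; exists y => //; rewrite -ry rr.
Qed.

Lemma forest_components n (G : sgraph n) (S : {set 'I_n}) :
  graph_acyclic G ->
  (2 * n_comp (induced_adj G S) S + edges2 G S <= 2 * #|S|)%N.
Proof.
move=> acG; have [R [cR conR]] := forest_transversal S acG.
have symS : connect_sym (induced_adj G S).
  apply: sym_connect_sym => x y.
  by rewrite /induced_adj adj_sym andbCA.
apply: leq_trans cR; rewrite leq_add2r leq_mul2l.
exact: n_comp_le_transversal.
Qed.

Lemma connected_boundary n (G : sgraph n) (S : {set 'I_n}) :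
  graph_connected G -> S != set0 -> S != setT ->
  exists x y, [/\ x \in S, y \notin S & G x y].
Proof.
move=> [_ conG] /set0Pn[x0 x0S] ST.
have [/exists_inP[x xS /exists_inP[y yS Gxy]]|] :=
  boolP [exists x in S, exists y in ~: S, G x y].
  by exists x, y; split=> //; move: yS; rewrite inE.
rewrite negb_exists_in => /forall_inP noedge.
case/negP: ST; apply/eqP/setP => y; rewrite inE.
have clS : fingraph.closed G [in S].
  apply: intro_closed; first by apply: sym_connect_sym; apply: adj_sym.
  move=> x z Gxz xS; apply: contraT => zS.
  have := noedge x xS; rewrite negb_exists_in => /forall_inP/(_ z).
  by rewrite inE Gxz => /(_ zS).
by have <- := closed_connect clS (conG x0 y).
Qed.

(** Starting from one vertex, an edge leaving the current set always exists; adding its far end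
    brings in at least one new edge per new vertex. *)
Lemma connected_edges n (G : sgraph n) :
  graph_connected G -> (2 * n.-1 <= edges2 G [set: 'I_n])%N.
Proof.
move=> conG; have [n_gt0 _] := conG.
suff grow k : (k < n)%N ->
    exists2 S : {set 'I_n}, #|S| = k.+1 & (2 * k <= edges2 G S)%N.
  have [|S cS eS] := grow n.-1; first by rewrite prednK.
  have <- // : S = setT.
  by apply/eqP; rewrite eqEcard subsetT cardsT card_ord cS prednK /=.
elim: k => [_|k IHk kn].
  exists [set Ordinal n_gt0]; first by rewrite cards1.
  by rewrite muln0.
have [S cS eS] := IHk (ltnW kn).
have [||x [y [xS yS Gxy]]] := connected_boundary conG (S := S).
- by rewrite -card_gt0 cS.
- by apply: contraTneq kn => ST; rewrite -cS ST cardsT card_ord ltnn.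
exists (y |: S); first by rewrite cardsU1 yS cS.
have sumy z : (\sum_(u in y |: S) G z u = G z y + \sum_(u in S) G z u)%N.
  by rewrite big_setU1.
rewrite /edges2 big_setU1 //= (eq_bigr _ (fun z _ => sumy z)) big_split /= sumy.
rewrite (big_setD1 x) //= [(\sum_(z in S) G z y)%N](big_setD1 x) //= Gxy adj_sym Gxy.
rewrite /edges2 in eS; rewrite adj_irr add0n.
move: eS; set e := (\sum_(i in S) _)%N.
by set u := (\sum_(i in S :\ x) _)%N; set v := (\sum_(i in S :\ x) _)%N; lia.
Qed.

Lemma tree_edges n (G : sgraph n) :
  is_tree G -> edges2 G [set: 'I_n] = (2 * n.-1)%N.
Proof.
move=> [conG acG]; apply/eqP; rewrite eqn_leq connected_edges // andbT.
have [n_gt0 _] := conG.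
have [R [cR conR]] := forest_transversal setT acG.
(* For the upper bound, a transversal of the whole vertex set has at least one element. *)
have [y yR _] := conR (Ordinal n_gt0) (in_setT _).
have : (0 < #|R|)%N by apply/card_gt0P; exists y; move: yR; rewrite inE => /andP[].
move: cR; rewrite cardsT card_ord; lia.
Qed.

Lemma connected_degree_gt0 n (G : sgraph n) (x : 'I_n) :
  graph_connected G -> (1 < n)%N -> (0 < \sum_y G x y)%N.
Proof.
move=> conG n_gt1.
have [||y [z [+ _ Gyz]]] := connected_boundary conG (S := [set x]).
- by apply/set0Pn; exists x; rewrite inE.
- by apply: contraTneq n_gt1 => eqT; rewrite -[n]card_ord -cardsT -eqT cards1.
rewrite inE => /eqP yx; rewrite (bigD1 z) //= -yx Gyz //.
Qed.

(** * Exchangeability of the future *)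

(** In [u * s] the permutation [u] acts first, hence on positions. The condition says that [w]
    depends on the first [t] activated vertices only. *)
Definition future_invariant (R : realType) n (t : nat) (w : 'S_n -> R) :=
  forall u s : 'S_n, (forall k : 'I_n, (k < t)%N -> u k = k) ->
    w (u * s)%g = w s.

Lemma future_invariantW (R : realType) n (t t' : nat) (w : 'S_n -> R) :
  (t <= t')%N -> future_invariant t w -> future_invariant t' w.
Proof.
by move=> tt' inv u s fix_u; apply: inv => k /leq_trans/(_ tt')/fix_u.
Qed.

Lemma exchange1 (R : realType) n t (w : 'S_n -> R) (f : 'I_n -> R)
    (i p : 'I_n) :
  future_invariant t w -> (t <= i)%N -> (t <= p)%N ->
  \sum_s w s * f (s i) = \sum_s w s * f (s p).
Proof.
move=> inv ti tp; rewrite (reindex_inj (mulgI (tperm i p))) /=.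
apply: eq_bigr => s _; rewrite permM tpermL inv // => k kt.
by rewrite tpermD // -val_eqE /= gtn_eqF // (leq_trans kt).
Qed.

Lemma exchange2 (R : realType) n t (w : 'S_n -> R) (f : 'I_n -> 'I_n -> R)
    (i j p q : 'I_n) :
  future_invariant t w -> (t <= i)%N -> (t <= j)%N -> (t <= p)%N ->
  (t <= q)%N -> i != j -> p != q ->
  \sum_s w s * f (s i) (s j) = \sum_s w s * f (s p) (s q).
Proof.
move=> inv ti tj tp tq ij pq.
(* The first transposition sends [i] to [p] and [j] to [j']; the second then sends [j'] to [q]
   without moving [p]. *)
pose j' := tperm i p j.
have j'p : j' != p by rewrite -(tpermL i p) (inj_eq perm_inj) eq_sym.
have tj' : (t <= j')%N by rewrite /j'; case: tpermP.
have tfix (a b k : 'I_n) : (t <= a)%N -> (t <= b)%N -> (k < t)%N -> tperm a b k = k.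
  move=> ta tb kt; rewrite tpermD // -val_eqE /= gtn_eqF //.
    exact: leq_trans kt ta.
  exact: leq_trans kt tb.
rewrite (reindex_inj (mulgI (tperm i p * tperm j' q)%g)) /=.
apply: eq_bigr => s _; rewrite inv => [|k kt]; last by rewrite permM !tfix.
by rewrite !permM tpermL -/j' tpermL tpermD 1?eq_sym // eq_sym.
Qed.

Lemma last_two_neq n (p q : 'I_n) : p.+1 = n -> q.+2 = n -> p != q.
Proof. by move=> pn qn; apply/eqP => pq; move: qn; rewrite -pq; lia. Qed.

Lemma card_late n t : (t <= n)%N -> (\sum_(i < n | t <= i) 1 = n - t)%N.
Proof.
move=> tn; rewrite -(big_geq_mkord t n xpredT (fun=> 1%N)) big_const_seq.
by rewrite count_predT size_iota iter_addn_0 mul1n.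
Qed.

Lemma late_sum1 (R : realType) n t (w : 'S_n -> R) (f : 'I_n -> R) (p : 'I_n) :
  future_invariant t w -> (t <= n)%N -> p.+1 = n ->
  \sum_s w s * (\sum_(i < n | (t <= i)%N) f (s i)) =
  (n%:R - t%:R) * \sum_s w s * f (s p).
Proof.
move=> inv tn pn; under eq_bigr do rewrite mulr_sumr.
rewrite exchange_big /= (eq_bigr (fun=> \sum_s w s * f (s p))).
  rewrite sumr_const -sum1_card [X in _ *+ X](card_late tn).
  by rewrite -[LHS]mulr_natl natrB.
move=> i ti; apply: (exchange1 _ inv) => //.
by rewrite -ltnS pn (leq_ltn_trans ti).
Qed.

Lemma late_sum2 (R : realType) n t (w : 'S_n -> R) (f : 'I_n -> 'I_n -> R)
    (p q : 'I_n) :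
  future_invariant t w -> (t <= n)%N -> p.+1 = n -> q.+2 = n ->
  \sum_s w s * (\sum_(i < n | (t <= i)%N) \sum_(j < n | (t <= j)%N && (j != i))
     f (s i) (s j)) =
  (n%:R - t%:R) * (n%:R - t%:R - 1) * \sum_s w s * f (s p) (s q).
Proof.
move=> inv tn pn qn.
pose F := \sum_s w s * f (s p) (s q).
have pq : p != q := last_two_neq pn qn.
under eq_bigr do rewrite mulr_sumr.
rewrite exchange_big /= (eq_bigr (fun=> (n%:R - t%:R - 1) * F)).
  rewrite sumr_const -sum1_card [X in _ *+ X](card_late tn).
  by rewrite -[LHS]mulr_natl natrB // mulrA.
move=> i ti; under eq_bigr do rewrite mulr_sumr.
rewrite exchange_big /= (eq_bigr (fun=> F)).
  rewrite sumr_const -sum1_card -[LHS]mulr_natl; congr (_ * _).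
  have := card_late tn; rewrite (bigD1 i) //= => eqc.
  by rewrite -natrB // -eqc natrD addrC addKr.
move=> j /andP[tj ji]; rewrite eq_sym in ji.
(* Two distinct late positions [i] and [j] force the last but one position to be late too. With
   fewer late positions, both sides of the statement vanish. *)
have lt_t : (t <= q)%N.
  rewrite -2!ltnS qn; move: ji; rewrite -val_eqE /= neq_ltn => /orP[ij|ji].
    by rewrite (leq_ltn_trans _ (ltn_ord j)) // (leq_ltn_trans ti).
  by rewrite (leq_ltn_trans _ (ltn_ord i)) // (leq_ltn_trans tj).
apply: (exchange2 _ inv) => //.
by rewrite -ltnS pn (leq_ltn_trans ti).
Qed.

(** * Degrees and the centred kernel of a tree *)

Definition deg (R : realType) n (G : sgraph n) (x : 'I_n) : R :=
  \sum_y (G x y)%:R.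

(* The function g of the header, set to 0 on the diagonal; the factor n - 2
   makes all its rows sum to 0. *)
Definition kernel (R : realType) n (G : sgraph n) (x y : 'I_n) : R :=
  if x == y then 0 else (n%:R - 2) * (G x y)%:R - deg R G x - deg R G y + 2.

Lemma kernelC (R : realType) n (G : sgraph n) (x y : 'I_n) :
  kernel R G x y = kernel R G y x.
Proof. by rewrite /kernel eq_sym adj_sym; case: eqP => // _; ring. Qed.

Lemma sum_deg (R : realType) n (G : sgraph n) :
  is_tree G -> \sum_x deg R G x = 2 * (n%:R - 1).
Proof.
move=> treeG; have [[n_gt0 _] _] := treeG.
have -> : \sum_x deg R G x = (edges2 G [set: 'I_n])%:R.
  rewrite /edges2 natr_sum; apply: eq_big => [x|x _]; first by rewrite inE.
  by rewrite natr_sum; apply: eq_bigl => y; rewrite inE.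
by rewrite tree_edges // natrM -subn1 natrB.
Qed.

Lemma deg_ge1 (R : realType) n (G : sgraph n) (x : 'I_n) :
  is_tree G -> (1 < n)%N -> 1 <= deg R G x.
Proof.
move=> [conG _] n_gt1; rewrite /deg -natr_sum ler1n.
exact: connected_degree_gt0.
Qed.

Lemma deg_le (R : realType) n (G : sgraph n) (x : 'I_n) :
  deg R G x <= n%:R - 1.
Proof.
rewrite /deg (bigD1 x) //= adj_irr add0r lerBrDr.
have -> : n%:R = \sum_(y : 'I_n) 1 :> R by rewrite sumr_const card_ord.
rewrite [leRHS](bigD1 x) //= [leLHS]addrC lerD2l.
by apply: ler_sum => y _; rewrite lern1 leq_b1.
Qed.

Lemma kernel_row (R : realType) n (G : sgraph n) (x : 'I_n) :
  is_tree G -> \sum_y kernel R G x y = 0.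
Proof.
move=> treeG; rewrite (bigD1 x) //= {1}/kernel eqxx add0r.
rewrite (eq_bigr (fun y =>
  (n%:R - 2) * (G x y)%:R - deg R G x - deg R G y + 2)); last first.
  by move=> y; rewrite eq_sym /kernel => /negPf->.
have := sum_deg R treeG; rewrite (bigD1 x) //= => sumd.
have degx : \sum_(y | y != x) (G x y)%:R = deg R G x.
  by rewrite /deg [RHS](bigD1 x) //= adj_irr add0r.
have cst (c : R) : \sum_(y < n | y != x) c = (n%:R - 1) * c.
  have : \sum_(y < n) c = n%:R * c by rewrite sumr_const card_ord mulr_natl.
  by rewrite (bigD1 x) //= => e; rewrite mulrBl mul1r -e [c + _]addrC addrK.
rewrite !big_split /= !sumrN -mulr_sumr degx !cst.
have -> : \sum_(y | y != x) deg R G y = 2 * (n%:R - 1) - deg R G x.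
  by rewrite -sumd addrAC subrr add0r.
by ring.
Qed.

(** * Component count at a given time, averaged over a stopping event *)

(** Inclusion-exclusion, used to express the edges among active vertices through the degrees of the
    inactive ones and the edges among these. *)
Lemma sum_square_split (R : realType) n (P : pred 'I_n)
    (F : 'I_n -> 'I_n -> R) :
  (forall i j, F i j = F j i) ->
  \sum_(i | P i) \sum_(j | P j) F i j =
  \sum_i \sum_j F i j - 2 * (\sum_(i | ~~ P i) \sum_j F i j)
  + \sum_(i | ~~ P i) \sum_(j | ~~ P j) F i j.
Proof.
move=> symF.
have split Q : \sum_(i | Q i) \sum_j F i j =
    \sum_(i | Q i) \sum_(j | P j) F i j + \sum_(i | Q i) \sum_(j | ~~ P j) F i j.
  by rewrite -big_split; apply: eq_bigr => i _; rewrite (bigID P).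
have cross : \sum_(i | P i) \sum_(j | ~~ P j) F i j =
    \sum_(i | ~~ P i) \sum_(j | P j) F i j.
  by rewrite exchange_big; apply: eq_bigr => i _; apply: eq_bigr => j _.
rewrite [X in X - _](bigID P) /= !split cross; ring.
Qed.

Lemma CC_le (R : realType) n (G : sgraph n) (s : 'S_n) t :
  is_tree G -> (t <= n)%N ->
  (CC G s t)%:R <= t%:R - (n%:R - 1)
    + \sum_(i < n | (t <= i)%N) deg R G (s i)
    - 2^-1 * \sum_(i < n | (t <= i)%N) \sum_(j < n | (t <= j)%N && (j != i))
        (G (s i) (s j))%:R.
Proof.
move=> treeG tn; have [_ acG] := treeG.
have card_active : #|active s t| = t.
  rewrite card_imset; last exact: perm_inj.
  rewrite -sum1_card -[RHS](card_ord t) -sum1_card.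
  by rewrite (big_ord_widen n (fun=> 1%N) tn); apply: eq_bigl => i; rewrite inE.
have eActive : (edges2 G (active s t))%:R =
    \sum_(i < n | (i < t)%N) \sum_(j < n | (j < t)%N) (G (s i) (s j))%:R :> R.
  rewrite natr_sum big_imset /=; last by move=> i j _ _; apply: perm_inj.
  apply: eq_big => [i|i _]; first by rewrite inE.
  rewrite natr_sum big_imset /=; last by move=> j k _ _; apply: perm_inj.
  by apply: eq_bigl => j; rewrite inE.
have := forest_components (active s t) acG.
rewrite -(ler_nat R) natrD card_active !natrM eActive.
rewrite (sum_square_split (fun i : 'I_n => (i < t)%N)); last first.
  by move=> i j; rewrite adj_sym.
have degE i : \sum_j (G (s i) (s j))%:R = deg R G (s i).
  by rewrite /deg [RHS](reindex_inj (@perm_inj _ s)).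
have -> : \sum_i \sum_j (G (s i) (s j))%:R = 2 * (n%:R - 1) :> R.
  rewrite -(sum_deg R treeG) [RHS](reindex_inj (@perm_inj _ s)) /=.
  exact: eq_bigr.
have -> : \sum_(i < n | ~~ (i < t)%N) \sum_j (G (s i) (s j))%:R =
    \sum_(i < n | (t <= i)%N) deg R G (s i).
  by apply: eq_big => [i|i _]; rewrite -?leqNgt ?degE.
have -> : \sum_(i < n | ~~ (i < t)%N) \sum_(j < n | ~~ (j < t)%N)
      (G (s i) (s j))%:R =
    \sum_(i < n | (t <= i)%N) \sum_(j < n | (t <= j)%N && (j != i))
      (G (s i) (s j))%:R :> R.
  apply: eq_big => [i|i]; rewrite -leqNgt // => ti.
  under eq_bigl do rewrite -leqNgt.
  by rewrite (bigD1 i) //= adj_irr add0r.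
rewrite /CC; lra.
Qed.

(** Exchangeability turns the late degree sum into [m] times the degree at the last position, and
    the late edge sum into [m * (m - 1)] times the adjacency at the last two. Eliminating the
    adjacency in favour of [kernel] is then pure algebra. *)
Lemma stage_le (R : realType) n (G : sgraph n) t (m : R) (w : 'S_n -> R)
    (p q : 'I_n) :
  is_tree G -> (2 < n)%N -> (t <= n)%N -> p.+1 = n -> q.+2 = n ->
  future_invariant t w -> (forall s, 0 <= w s) -> m = n%:R - t%:R ->
  \sum_s w s * (CC G s t)%:R <=
  \sum_s w s * (1 + (deg R G (s p) - 1) * (m * (n%:R - 1 - m) / (n%:R - 2))
    - m * (m - 1) / (2 * (n%:R - 2)) * kernel R G (s p) (s q)).
Proof.
move=> treeG n_gt2 tn pn qn inv w_ge0 mE.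
pose f x := (deg R G x); pose a x y : R := (G x y)%:R.
have n2 : n%:R - 2 != 0 :> R by rewrite subr_eq0 eqr_nat gtn_eqF.
have pq : p != q := last_two_neq pn qn.
pose S0 := \sum_s w s; pose SD := \sum_s w s * f (s p).
pose SD' := \sum_s w s * f (s q); pose SA := \sum_s w s * a (s p) (s q).
(* The last two degrees may be exchanged only if both positions are late; otherwise [m] is 0 or 1
   and the coefficient vanishes. *)
have eqSD : m * (m - 1) * SD' = m * (m - 1) * SD.
  have [tq|qt] := leqP t q.
    congr (_ * _); apply: (exchange1 _ inv) => //.
    lia.
  suff -> : m * (m - 1) = 0 by rewrite !mul0r.
  have : t = n \/ t.+1 = n by lia.
  by rewrite mE => -[<-|<-]; rewrite ?subrr ?mul0r // -natr1; ring.
apply: (@le_trans _ _ (\sum_s (w s * (t%:R - (n%:R - 1))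
    + w s * (\sum_(i < n | (t <= i)%N) f (s i))
    - 2^-1 * (w s * (\sum_(i < n | (t <= i)%N) \sum_(j < n | (t <= j)%N && (j != i))
        a (s i) (s j)))))).
  apply: ler_sum => s _.
  rewrite mulrCA -mulrN -!mulrDr; apply: ler_wpM2l; first exact: w_ge0.
  exact: CC_le.
rewrite !big_split /= sumrN -mulr_sumr -mulr_suml (late_sum1 f inv tn pn).
rewrite (late_sum2 a inv tn pn qn) -mE -/S0 -/SD -/SA.
have -> : \sum_s w s * (1 + (deg R G (s p) - 1) * (m * (n%:R - 1 - m) / (n%:R - 2))
    - m * (m - 1) / (2 * (n%:R - 2)) * kernel R G (s p) (s q)) =
  S0 + (SD - S0) * (m * (n%:R - 1 - m) / (n%:R - 2))
  - m * (m - 1) / (2 * (n%:R - 2)) * ((n%:R - 2) * SA - SD - SD' + 2 * S0).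
  rewrite /SD /SD' /S0 /SA -!sumrN !mulr_sumr -!big_split /= !mulr_suml !mulr_sumr.
  rewrite -sumrN -!big_split /=; apply: eq_bigr => s _.
  by rewrite /kernel (inj_eq perm_inj) (negPf pq) /f /a; ring.
have -> : m * (m - 1) / (2 * (n%:R - 2)) * ((n%:R - 2) * SA - SD - SD' + 2 * S0) =
  (m * (m - 1) * ((n%:R - 2) * SA - SD + 2 * S0) - m * (m - 1) * SD')
  / (2 * (n%:R - 2)).
  by ring.
rewrite eqSD le_eqVlt; apply/orP; left; apply/eqP.
have -> : t%:R = n%:R - m :> R by rewrite mE; ring.
by field.
Qed.

(** * Second moment of the degenerate U-statistic *)

Lemma sum_constant_ge0 (R : realType) (I : finType) (P : pred I) (f : I -> R)
    (i : I) :
  P i -> (forall j, P j -> f j = f i) -> 0 <= \sum_(j | P j) f j -> 0 <= f i.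
Proof.
move=> Pi cst; rewrite (eq_bigr (fun=> f i)) // sumr_const pmulrn_lge0 //.
by apply/card_gt0P; exists i.
Qed.

(* By symmetry and the vanishing of the row sums, the entries of h with exactly
   one index in {p, q} are nonpositive, and those with none are nonnegative.
   Dropping the former and enlarging the range of the latter to all indices
   outside of {p, q} only increases the sum. *)
Lemma centered_kernel_sum_le (R : realType) n (h : 'I_n -> 'I_n -> R)
    (P : pred 'I_n) (p q : 'I_n) :
  (forall i j, h i j = h j i) -> (forall i, h i i = 0) ->
  (forall i, \sum_j h i j = 0) -> 0 <= h p q ->
  (forall (u : 'S_n) i j, u p = p -> u q = q -> h (u i) (u j) = h i j) ->
  p != q -> P p -> P q ->
  \sum_(i | P i) \sum_(j | P j) h i j <= 4 * h p q.
Proof.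
move=> hC h0 row hpq_ge0 inv pq Pp Pq.
have qp : q != p by rewrite eq_sym.
have rest i : \sum_(j | (j != p) && (j != q)) h i j = - (h i p + h i q).
  have := row i; rewrite (bigD1 p) //= (bigD1 q) //= addrA => /eqP.
  by rewrite addrC addr_eq0 => /eqP.
(* The transposition of [i] and [k] fixes [p], [q] and [j]; here [j] itself may be [p] or [q]. *)
have swap i j k : i != p -> i != q -> k != p -> k != q -> i != j -> k != j ->
    h j k = h j i.
  move=> ip iq kp kq ij kj.
  by have := inv (tperm i k) j i; rewrite tpermL !tpermD // => ->.
have hp i : i != p -> i != q -> h i p <= 0.
  move=> ip iq; rewrite hC -oppr_ge0.
  apply: (@sum_constant_ge0 _ _ (fun j => (j != p) && (j != q)) (fun j => - h p j)).
  - by rewrite ip.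
  - by move=> j /andP[jp jq]; congr (- _); apply: swap.
  - by rewrite sumrN rest h0 add0r opprK.
have hq i : i != p -> i != q -> h i q <= 0.
  move=> ip iq; rewrite hC -oppr_ge0.
  apply: (@sum_constant_ge0 _ _ (fun j => (j != p) && (j != q)) (fun j => - h q j)).
  - by rewrite ip.
  - by move=> j /andP[jp jq]; congr (- _); apply: swap.
  - by rewrite sumrN rest h0 addr0 opprK hC.
have hrest i j : i != p -> i != q -> j != p -> j != q -> 0 <= h i j.
  move=> ip iq jp jq; have [->|ij] := eqVneq i j; first by rewrite h0.
  apply: (@sum_constant_ge0 _ _ (fun j => [&& j != p, j != q & j != i]) (h i)).
  - by rewrite jp jq eq_sym.
  - by move=> k /and3P[kp kq ki]; apply: swap; rewrite // eq_sym.
  have := rest i; rewrite (bigD1 i) ?ip //= h0 add0r.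
  under eq_bigl do rewrite -andbA.
  by move=> ->; have := hp _ ip iq; have := hq _ ip iq; lra.
have rowp : \sum_(j | P j) h p j <= h p q.
  rewrite (bigD1 p) //= h0 add0r (bigD1 q) ?Pq //= gerDl.
  by apply: sumr_le0 => j /andP[/andP[_ jp] jq]; rewrite hC hp.
have rowq : \sum_(j | P j) h q j <= h p q.
  rewrite (bigD1 p) //= (bigD1 q) ?Pq //= h0 add0r hC gerDl.
  by apply: sumr_le0 => j /andP[/andP[_ jp] jq]; rewrite hC hq.
have row_rest i : i != p -> i != q -> \sum_(j | P j) h i j <= - (h i p + h i q).
  move=> ip iq; rewrite -rest (bigD1 p) //= (bigD1 q) ?Pq //=.
  apply: (@le_trans _ _ (\sum_(j | P j && (j != p) && (j != q)) h i j)).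
    have := hp _ ip iq; have := hq _ ip iq; lra.
  rewrite big_mkcond [leRHS]big_mkcond; apply: ler_sum => j _.
  by case: (P j) => //=; case: ifP => // /andP[jp jq]; rewrite hrest.
(* Rows [p] and [q] contribute at most [h p q] each, all other rows together at most [2 * h p q]. *)
have -> : 4 * h p q = h p q + (h p q + 2 * h p q) by ring.
rewrite (bigD1 p) //=; apply: lerD => //; rewrite (bigD1 q) ?Pq //=; apply: lerD => //.
have -> : 2 * h p q = \sum_(i | (i != p) && (i != q)) - (h i p + h i q).
  rewrite sumrN big_split /= (eq_bigr (h p)) // [X in _ + X](eq_bigr (h q)) //.
  by rewrite !rest !h0 (hC q p); ring.
rewrite big_mkcond [leRHS]big_mkcond; apply: ler_sum => i _.
case: (boolP (i != p)) => ip; rewrite ?andbF //=.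
case: (boolP (i != q)) => iq; rewrite ?andbF //=.
case: (P i) => /=; first exact: row_rest.
by have := hp _ ip iq; have := hq _ ip iq; lra.
Qed.

(** The late sum [W] is symmetric in the late positions, hence itself a future-invariant weight. In
    [W * W] one factor can thus be replaced by a multiple of the kernel at [p] and [q], which leaves
    a sum of the covariances [h i j]. These inherit the symmetry and the zero row sums of the
    kernel. *)
Lemma deviation_second_moment (R : realType) n (G : sgraph n) t (p q : 'I_n) :
  is_tree G -> (t.+2 <= n)%N -> p.+1 = n -> q.+2 = n ->
  \sum_(s : 'S_n) (\sum_(i < n | (t <= i)%N) \sum_(j < n | (t <= j)%N && (j != i))
     kernel R G (s i) (s j)) ^+ 2 <=
  4 * ((n%:R - t%:R) * (n%:R - t%:R - 1)) *
  \sum_(s : 'S_n) kernel R G (s p) (s q) ^+ 2.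
Proof.
move=> treeG tn pn qn.
pose K := kernel R G.
pose W (s : 'S_n) := \sum_(i < n | (t <= i)%N)
  \sum_(j < n | (t <= j)%N && (j != i)) K (s i) (s j).
have WE s : W s = \sum_(i < n | (t <= i)%N) \sum_(j < n | (t <= j)%N) K (s i) (s j).
  apply: eq_bigr => i ti; rewrite [RHS](bigD1 i) //=.
  by rewrite {2}/K /kernel eqxx add0r.
have pq : p != q := last_two_neq pn qn.
have Winv : future_invariant t W.
  move=> u s fix_u; rewrite !WE.
  have late_u i : (t <= u i)%N = (t <= i)%N.
    apply/idP/idP => [|ti].
      by apply: contraTT; rewrite -!ltnNge => it; rewrite fix_u.
    rewrite leqNgt; apply/negP => uit.
    by have /perm_inj ui := fix_u _ uit; rewrite ui ltnNge ti in uit.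
  rewrite [RHS](reindex_inj (@perm_inj _ u)).
  apply: eq_big => [i|i _]; first by rewrite late_u.
  rewrite [RHS](reindex_inj (@perm_inj _ u)).
  apply: eq_big => [j|j _]; first by rewrite late_u.
  by rewrite !permM.
rewrite (eq_bigr (fun s => W s * W s)); last by move=> s _; rewrite expr2.
rewrite (late_sum2 K Winv _ pn qn); last by rewrite ltnW // ltnW.
rewrite [4 * _]mulrC -[leRHS]mulrA; apply: ler_wpM2l.
  have : (t.+2)%:R <= n%:R :> R by rewrite ler_nat.
  by rewrite -2!natr1 => tnR; apply: mulr_ge0; lra.
pose h i j := \sum_(s : 'S_n) K (s i) (s j) * K (s p) (s q).
have -> : \sum_s W s * K (s p) (s q) =
    \sum_(i < n | (t <= i)%N) \sum_(j < n | (t <= j)%N) h i j.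
  under eq_bigr do rewrite WE mulr_suml.
  rewrite exchange_big; apply: eq_bigr => i _.
  by under eq_bigr do rewrite mulr_suml; rewrite exchange_big; apply: eq_bigr.
have -> : \sum_(s : 'S_n) kernel R G (s p) (s q) ^+ 2 = h p q.
  by apply: eq_bigr => s _; rewrite expr2.
apply: centered_kernel_sum_le => //.
- by move=> i j; apply: eq_bigr => s _; rewrite /K kernelC.
- by move=> i; rewrite /h big1 // => s _; rewrite /K {1}/kernel eqxx mul0r.
- move=> i; rewrite /h exchange_big big1 //= => s _; rewrite -mulr_suml.
  rewrite -[X in X * _]
    (reindex_inj (@perm_inj _ s) (F := K (s i)) (P := predT)) /=.
  by rewrite kernel_row // mul0r.
- by apply: sumr_ge0 => s _; rewrite -expr2 sqr_ge0.
- move=> u i j up uq; rewrite /h [RHS](reindex_inj (mulgI u)) /=.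
  by apply: eq_bigr => s _; rewrite !permM up uq.
- by rewrite /=; lia.
- by rewrite /=; lia.
Qed.

(** * Averages over a uniformly random order *)

Lemma cst_invariant (R : realType) n : @future_invariant R n 0 (fun=> 1).
Proof. by []. Qed.

Lemma sum_perm_deg (R : realType) n (G : sgraph n) (p : 'I_n) :
  is_tree G -> n%:R * \sum_(s : 'S_n) deg R G (s p) = n`!%:R * (2 * (n%:R - 1)).
Proof.
move=> treeG.
have <- : \sum_(s : 'S_n) \sum_(i < n) deg R G (s i) = n`!%:R * (2 * (n%:R - 1)).
  rewrite (eq_bigr (fun=> 2 * (n%:R - 1))).
    by rewrite sumr_const card_Sn [RHS]mulr_natl.
  by move=> s _; rewrite -(sum_deg R treeG) [RHS](reindex_inj (@perm_inj _ s)).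
rewrite [RHS]exchange_big /= [RHS](eq_bigr (fun=> \sum_(s : 'S_n) deg R G (s p))).
  by rewrite sumr_const card_ord [LHS]mulr_natl.
move=> i _; have := exchange1 (deg R G) (@cst_invariant R n) (leq0n i) (leq0n p).
by rewrite -!mulr_sumr !mul1r.
Qed.

Lemma sum_perm_adj (R : realType) n (G : sgraph n) (p q : 'I_n) :
  is_tree G -> (1 < n)%N -> p.+1 = n -> q.+2 = n ->
  n%:R * \sum_(s : 'S_n) (G (s p) (s q))%:R = n`!%:R * 2 :> R.
Proof.
move=> treeG n_gt1 pn qn.
have := late_sum2 (fun x y => (G x y)%:R) (@cst_invariant R n) (leq0n n) pn qn.
rewrite (eq_bigr (fun=> 2 * (n%:R - 1))); last first.
  move=> s _; rewrite mul1r -(sum_deg R treeG) [RHS](reindex_inj (@perm_inj _ s)) /=.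
  apply: eq_bigr => i _; rewrite /deg [RHS](reindex_inj (@perm_inj _ s)) /=.
  by rewrite [RHS](bigD1 i) //= adj_irr add0r.
rewrite -mulr_sumr mul1r sumr_const card_Sn subr0 -[LHS]mulr_natl => e.
have n1 : n%:R - 1 != 0 :> R by rewrite subr_eq0 pnatr_eq1 gtn_eqF.
apply: (mulIf n1); rewrite [LHS]mulrAC -e; ring.
Qed.

Lemma sum_perm_kernel_sq (R : realType) n (G : sgraph n) (p q : 'I_n) :
  is_tree G -> (2 < n)%N -> p.+1 = n -> q.+2 = n ->
  \sum_(s : 'S_n) kernel R G (s p) (s q) ^+ 2 <= n`!%:R * (8 * n%:R).
Proof.
move=> treeG n_gt2 pn qn.
have pq : p != q := last_two_neq pn qn.
have nR : 3 <= n%:R :> R by rewrite (ler_nat R 3 n).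
pose SD r := \sum_(s : 'S_n) deg R G (s r).
pose SA := \sum_(s : 'S_n) (G (s p) (s q))%:R : R.
(* The kernel is a difference of two nonnegative numbers, [n - 2] times the adjacency and the degree
   sum minus 2, each at most [2 * n]. Its square is therefore at most [2 * n] times their sum, whose
   mean is bounded. *)
apply: (@le_trans _ _ (2 * n%:R * ((n%:R - 2) * SA + SD p + SD q - 2 * n`!%:R))).
  have -> : 2 * n%:R * ((n%:R - 2) * SA + SD p + SD q - 2 * n`!%:R) =
    \sum_(s : 'S_n) 2 * n%:R * ((n%:R - 2) * (G (s p) (s q))%:R + deg R G (s p)
       + deg R G (s q) - 2).
    rewrite -mulr_sumr !big_split /= -mulr_sumr sumr_const card_Sn.
    rewrite -/SA -/(SD p) -/(SD q).
    by rewrite -[_ *+ _]mulr_natl; ring.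
  apply: ler_sum => s _; rewrite /kernel (inj_eq perm_inj) (negPf pq).
  have n_gt1 := ltnW n_gt2.
  have := deg_ge1 R (s p) treeG n_gt1; have := deg_ge1 R (s q) treeG n_gt1.
  have := deg_le R G (s p); have := deg_le R G (s q).
  move: (deg R G (s p)) (deg R G (s q)) => d d' h1 h2 h3 h4.
  by case: (G _ _) => /=; nra.
have eA : n%:R * SA = n`!%:R * 2 by apply: sum_perm_adj => //; apply: ltnW.
have eD r : n%:R * SD r = n`!%:R * (2 * (n%:R - 1)) by apply: sum_perm_deg.
have -> : 2 * n%:R * ((n%:R - 2) * SA + SD p + SD q - 2 * n`!%:R) =
  2 * ((n%:R - 2) * (n%:R * SA) + n%:R * SD p + n%:R * SD q
    - 2 * n%:R * n`!%:R) by ring.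
rewrite eA !eD; have : 0 <= n`!%:R :> R by rewrite ler0n.
by move: (n`!%:R) => F F0; nra.
Qed.

(** * Bounding the score of a stopping algorithm *)

Lemma stopping_invariant (R : realType) n (A : {ffun 'S_n -> 'I_n.+1}) t :
  stopping_algorithm A ->
  future_invariant t (fun s => (A s == t :> nat)%:R : R).
Proof.
move=> /stopping_algorithmP stA u s fix_u; congr (nat_of_bool _)%:R.
apply/eqP/eqP => [Aus|As].
  by rewrite (stA (u * s)%g s) // => i; rewrite Aus => it; rewrite permM fix_u.
by rewrite (stA s (u * s)%g) // => i; rewrite As => it; rewrite permM fix_u.
Qed.

(** Arithmetic-geometric mean inequality; it lets a second moment control the mean deviation,
    without square roots. *)
Lemma normr_le_sq (R : realType) (x eta : R) :
  0 < eta -> `|x| <= (eta + x ^+ 2 / eta) / 2.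
Proof.
move=> eta0; have eta2 : 0 < 2 * eta by rewrite mulr_gt0.
rewrite -(ler_pM2r eta2).
have -> : (eta + x ^+ 2 / eta) / 2 * (2 * eta) = eta ^+ 2 + x ^+ 2.
  by field; rewrite gt_eqF.
rewrite -[x ^+ 2]real_normK ?num_real //; have := sqr_ge0 (eta - `|x|); lra.
Qed.

(* Before time n - m the kernel at the last two positions is replaced by its
   average over the last m positions; after that time it is bounded crudely. *)
Lemma score_le (R : realType) n (G : sgraph n) (A : {ffun 'S_n -> 'I_n.+1})
    (m : nat) (eta : R) :
  is_tree G -> stopping_algorithm A -> (2 < n)%N -> (1 < m <= n)%N -> 0 < eta ->
  score R G A <= 1 + n%:R / 4 + n%:R * eta / 2
    + 16 * n%:R ^+ 2 / (eta * (m%:R * (m%:R - 1))) + m%:R ^+ 2 / n%:R.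
Proof.
move=> treeG stA n_gt2 /andP[m_gt1 mn] eta0.
have [p pn] : exists p : 'I_n, p.+1 = n.
  have h : (n.-1 < n)%N by lia.
  by exists (Ordinal h) => /=; lia.
have [q qn] : exists q : 'I_n, q.+2 = n.
  have h : (n.-2 < n)%N by lia.
  by exists (Ordinal h) => /=; lia.
have nR : 3 <= n%:R :> R by rewrite (ler_nat R 3 n).
have mR : 2 <= m%:R :> R by rewrite (ler_nat R 2 m).
have mnR : m%:R <= n%:R :> R by rewrite ler_nat.
have pq : p != q := last_two_neq pn qn.
pose T := (n - m)%N.
have TR : n%:R - T%:R = m%:R :> R by rewrite natrB // opprB addrC subrK.
pose M : R := m%:R * (m%:R - 1).
have M0 : 0 < M by rewrite /M; nra.
pose d x := deg R G x; pose K := kernel R G.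
pose Z (s : 'S_n) := M^-1 * \sum_(i < n | (T <= i)%N)
  \sum_(j < n | (T <= j)%N && (j != i)) K (s i) (s j).
(* [K1] is the maximum over real [r] of [r * (n - 1 - r) / (n - 2)], attained at half of [n - 1].
   [K2] and [K3] dominate the coefficient of the kernel when at most [n], respectively at most [m],
   vertices are inactive. *)
pose K1 : R := (n%:R - 1) ^+ 2 / (4 * (n%:R - 2)).
pose K2 : R := n%:R * (n%:R - 1) / (2 * (n%:R - 2)).
pose K3 : R := m%:R ^+ 2 / (2 * (n%:R - 2)).
(* The majorant does not mention the stopping time, so the bounds for the separate times add up to
   its plain sum over all orders. *)
pose Phi (s : 'S_n) := 1 + (d (s p) - 1) * K1 + K2 * ((eta + Z s ^+ 2 / eta) / 2)
  + K3 * (d (s p) + d (s q) - 2).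
have n2_gt0 : 0 < n%:R - 2 :> R by lra.
have K1_ge0 : 0 <= K1 by rewrite divr_ge0 ?sqr_ge0 ?mulr_ge0 // ltW.
have K2_ge0 : 0 <= K2 by rewrite /K2 divr_ge0 ?mulr_ge0 //; lra.
have K3_ge0 : 0 <= K3 by rewrite /K3 divr_ge0 ?sqr_ge0 ?mulr_ge0 // ltW.
have d1 x : 1 <= d x by apply: deg_ge1 => //; apply: ltnW.
have Kge x y : x != y -> - K x y <= d x + d y - 2.
  move=> xy; rewrite /K /kernel (negPf xy) -/(d x) -/(d y).
  by case: (G x y) => /=; lra.
pose w t (s : 'S_n) : R := (A s == t :> nat)%:R.
have w_ge0 t s : 0 <= w t s by rewrite ler0n.
have stage t : (t <= n)%N ->
    \sum_s w t s * (CC G s t)%:R <= \sum_s w t s * Phi s.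
  move=> tn; have inv : future_invariant t (w t) by apply: stopping_invariant.
  apply: le_trans (stage_le treeG n_gt2 tn pn qn inv (w_ge0 t) erefl) _.
  set r : R := n%:R - t%:R.
  have r_ge0 : 0 <= r by rewrite subr_ge0 ler_nat.
  have r_le : r <= n%:R by rewrite lerBlDr lerDl.
  have r_int : 0 <= r * (r - 1).
    move: tn; rewrite leq_eqVlt => /predU1P[tE|]; first by rewrite /r tE subrr mul0r.
    by rewrite -(ler_nat R) -natr1 => ?; rewrite mulr_ge0 // /r; lra.
  pose c := r * (r - 1) / (2 * (n%:R - 2)).
  have c_ge0 : 0 <= c by rewrite divr_ge0 // mulr_ge0 // ltW.
  have main (s : 'S_n) :
      (d (s p) - 1) * (r * (n%:R - 1 - r) / (n%:R - 2)) <= (d (s p) - 1) * K1.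
    apply: ler_wpM2l; first by rewrite subr_ge0.
    have K1E : K1 * (n%:R - 2) = (n%:R - 1) ^+ 2 / 4.
      by rewrite /K1; field; rewrite gt_eqF.
    rewrite ler_pdivrMr // K1E; have := sqr_ge0 (n%:R - 1 - 2 * r); lra.
  have sqd (s : 'S_n) : 0 <= d (s p) + d (s q) - 2.
    by have := d1 (s p); have := d1 (s q); lra.
  have [tT|Tt] := leqP t T.
    have c_le : c <= K2.
      rewrite /c /K2 ler_wpM2r ?invr_ge0 ?mulr_ge0 ?(ltW n2_gt0) //; nra.
    (* A weight determined by time [t] is also determined by the later time [T], so the kernel may
       be averaged over the pairs of positions from [T] on. *)
    have toZ : \sum_s w t s * K (s p) (s q) = \sum_s w t s * Z s.
      have invT := future_invariantW tT inv.
      rewrite /Z; under [RHS]eq_bigr do rewrite mulrCA.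
      rewrite -mulr_sumr (late_sum2 K invT _ pn qn) ?leq_subr // TR -/M.
      by rewrite mulKf // gt_eqF.
    apply: (@le_trans _ _ (\sum_s (w t s * (1 + (d (s p) - 1) * K1)
        - c * (w t s * K (s p) (s q))))).
      apply: ler_sum => s _; rewrite [c * _]mulrCA -mulrBr.
      by apply: ler_wpM2l => //; rewrite -/d -/K -/c lerD2r lerD2l main.
    rewrite big_split /= sumrN -mulr_sumr toZ mulr_sumr -sumrN -big_split /=.
    apply: ler_sum => s _; rewrite [c * _]mulrCA -mulrBr; apply: ler_wpM2l => //.
    rewrite /Phi -[leRHS]addrA lerD2l; apply: le_trans (_ : c * `|Z s| <= _).
      by rewrite -mulrN ler_wpM2l // -normrN ler_norm.
    apply: (@le_trans _ _ (K2 * ((eta + Z s ^+ 2 / eta) / 2))); last first.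
      by rewrite lerDl mulr_ge0.
    by apply: ler_pM => //; apply: normr_le_sq.
  have c_le : c <= K3.
    have : (n <= t + m)%N by rewrite addnC -leq_subLR ltnW.
    rewrite -(ler_nat R) natrD => ntm.
    have rm : r <= m%:R by rewrite /r; lra.
    rewrite /c /K3 ler_wpM2r ?invr_ge0 ?mulr_ge0 ?(ltW n2_gt0) //; nra.
  apply: ler_sum => s _; apply: ler_wpM2l => //.
  rewrite -/d -/K -/c /Phi -[leRHS]addrA; apply: lerD; first by rewrite lerD2l main.
  rewrite -mulrN; apply: (@le_trans _ _ (K3 * (d (s p) + d (s q) - 2))).
    apply: (@le_trans _ _ (c * (d (s p) + d (s q) - 2))).
      by apply: ler_wpM2l => //; apply: Kge; rewrite (inj_eq perm_inj).
    exact: ler_wpM2r.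
  rewrite lerDr.
  by rewrite mulr_ge0 // divr_ge0 // addr_ge0 ?divr_ge0 ?sqr_ge0 // ltW.
have collapse (F : 'S_n -> nat -> R) :
    \sum_s F s (A s) = \sum_(t < n.+1) \sum_s w t s * F s t.
  rewrite exchange_big /=; apply: eq_bigr => s _.
  rewrite (bigD1 (A s)) //= /w eqxx mul1r big1 ?addr0 // => t /negPf tA.
  by rewrite eq_sym val_eqE tA mul0r.
have total : \sum_s (CC G s (A s))%:R <= \sum_s Phi s.
  rewrite (collapse (fun s t => (CC G s t)%:R)) (collapse (fun s t => Phi s)).
  by apply: ler_sum => t _; apply: stage; rewrite -ltnS.
pose F : R := n`!%:R.
have F0 : 0 < F by rewrite ltr0n fact_gt0.
have n0 : 0 < n%:R :> R by lra.
have sumd r : \sum_(s : 'S_n) d (s r) = F * (2 * (n%:R - 1) / n%:R).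
  apply: (mulfI (lt0r_neq0 n0)); rewrite (sum_perm_deg R r treeG) -/F.
  by field; rewrite gt_eqF.
have sumZ : \sum_s Z s ^+ 2 <= F * (32 * n%:R / M).
  rewrite /Z; under eq_bigr do rewrite exprMn.
  rewrite -mulr_sumr.
  have T2 : (T.+2 <= n)%N by rewrite /T; clear -m_gt1 mn; lia.
  have := deviation_second_moment R treeG T2 pn qn; rewrite TR -/M => dev.
  have sq := sum_perm_kernel_sq R treeG n_gt2 pn qn.
  apply: (@le_trans _ _ (M^-1 ^+ 2 * (4 * M * (F * (8 * n%:R))))).
    apply: ler_wpM2l; first exact: sqr_ge0.
    by apply: le_trans dev _; apply: ler_wpM2l => //; rewrite mulr_ge0 // ltW.
  rewrite le_eqVlt; apply/orP; left; apply/eqP; field; by rewrite gt_eqF.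
have sumPhi : \sum_s Phi s <= F * (1 + (n%:R - 1) ^+ 2 / (4 * n%:R)
    + K2 * eta / 2 + K2 * (16 * n%:R / (eta * M)) + m%:R ^+ 2 / n%:R).
  have -> : \sum_s Phi s = F * (1 - K1 + K2 * eta / 2 - 2 * K3)
      + K1 * (\sum_(s : 'S_n) d (s p)) + K2 / (2 * eta) * (\sum_s Z s ^+ 2)
      + K3 * (\sum_(s : 'S_n) d (s p) + \sum_(s : 'S_n) d (s q)).
    have -> : F * (1 - K1 + K2 * eta / 2 - 2 * K3) =
        \sum_(s : 'S_n) (1 - K1 + K2 * eta / 2 - 2 * K3).
      by rewrite sumr_const card_Sn [LHS]mulr_natl.
    rewrite mulrDr !mulr_sumr -!big_split /=; apply: eq_bigr => s _.
    by rewrite /Phi; field; rewrite gt_eqF.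
  rewrite !sumd.
  apply: (@le_trans _ _ (F * (1 - K1 + K2 * eta / 2 - 2 * K3) +
    K1 * (F * (2 * (n%:R - 1) / n%:R)) + K2 / (2 * eta) * (F * (32 * n%:R / M)) +
    K3 * (F * (2 * (n%:R - 1) / n%:R) + F * (2 * (n%:R - 1) / n%:R)))).
    rewrite lerD2r lerD2l; apply: ler_wpM2l => //.
    by rewrite divr_ge0 // mulr_ge0 // ltW.
  rewrite le_eqVlt; apply/orP; left; apply/eqP; rewrite /K1 /K3.
  by field; rewrite !gt_eqF.
have K2n : K2 <= n%:R.
  rewrite /K2 ler_pdivrMr ?mulr_gt0 // ler_wpM2l //; lra.
rewrite /score; apply: (@le_trans _ _ (F^-1 * \sum_s Phi s)).
  by apply: ler_wpM2l => //; rewrite invr_ge0 ltW.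
rewrite mulrC ler_pdivrMr //; apply: le_trans sumPhi _; rewrite [leRHS]mulrC.
apply: ler_wpM2l; first exact: ltW.
rewrite lerD2r; apply: lerD.
  apply: lerD.
    rewrite lerD2l ler_pdivrMr ?mulr_gt0 // mulrAC ler_pdivlMr // ; nra.
  by have := ler_wpM2r (ltW eta0) K2n; lra.
have -> : 16 * n%:R ^+ 2 / (eta * M) = n%:R * (16 * n%:R / (eta * M)) by ring.
by apply: ler_wpM2r => //; rewrite divr_ge0 // mulr_ge0 // ltW.
Qed.

(** * Choice of the parameters *)

Theorem theorem3p2 (R : realType) (eps : R) (eps_gt0 : 0 < eps) :
  exists N : nat, forall (n : nat) (G : sgraph n),
    is_tree G -> (N <= n)%N -> max_score R G <= (1 / 4 + eps) * n%:R.
Proof.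
(* The cutoff [m] will be [n] divided by [k]; [4 <= k * eps] keeps the loss [m ^ 2 / n] from late
   stopping below [eps / 4 * n]. *)
pose k := (Num.bound (4 / eps)).+1.
have kR : 4 <= k%:R * eps.
  have : 4 / eps < (Num.bound (4 / eps))%:R.
    by apply: archi_boundP; rewrite divr_ge0 // ltW.
  rewrite ltr_pdivrMr // => /ltW/le_trans; apply.
  by rewrite ler_pM2r // ler_nat.
have k_gt0 : (0 < k)%N by [].
have k_ge1 : 1 <= k%:R :> R by rewrite ler1n.
clearbody k.
(* Once [n] exceeds [C], the terms that do not grow with [n] fit into [eps / 2 * n]. With
   [eta = eps / 2], the remaining two errors take [eps / 4 * n] each. *)
pose C : R := (1 + 128 * k%:R ^+ 2 / eps) * 2 / eps.
have C_ge0 : 0 <= C.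
  by rewrite /C !(divr_ge0, mulr_ge0, addr_ge0, sqr_ge0) // ltW.
exists (maxn (4 * k) (Num.bound C)) => n G treeG; rewrite geq_max => /andP[n4k nC].
have nCR : C <= n%:R by apply/ltW/(lt_le_trans (archi_boundP C_ge0)); rewrite ler_nat.
have [m [mk nmk m_gt1]] : exists m,
    [/\ (m * k <= n)%N, (n < m.+1 * k)%N & (1 < m <= n)%N].
  exists (n %/ k)%N; split; [exact: leq_divM|exact: ltn_ceil|].
  by rewrite leq_div andbT leq_divRL //; lia.
have [[A stA ->] _] := max_scoreP R G.
have eta_gt0 : 0 < eps / 2 by rewrite divr_gt0.
have n_gt2 : (2 < n)%N by lia.
apply: le_trans (score_le treeG stA n_gt2 m_gt1 eta_gt0) _.
have mR : 2 <= m%:R :> R by rewrite (ler_nat R 2 m); case/andP: m_gt1.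
have n4kR : 4 * k%:R <= n%:R :> R by rewrite -natrM ler_nat.
have mkR : m%:R * k%:R <= n%:R :> R by rewrite -natrM ler_nat.
have nmkR : n%:R <= (m%:R + 1) * k%:R :> R by rewrite natr1 -natrM ler_nat ltnW.
have n_gt0 : 0 < n%:R :> R by lra.
have sq_term : m%:R ^+ 2 / n%:R <= eps / 4 * n%:R.
  have mn : m%:R * 4 <= n%:R * eps.
    apply: (@le_trans _ _ (m%:R * k%:R * eps)); first by rewrite -mulrA ler_wpM2l.
    by rewrite ler_wpM2r // ltW.
  have m_le : m%:R <= n%:R :> R by rewrite ler_nat; case/andP: m_gt1.
  rewrite ler_pdivrMr //.
  have := ler_wpM2l (ler0n R m) m_le; have := ler_wpM2r (ltW n_gt0) mn; lra.
have dev_term : 16 * n%:R ^+ 2 / (eps / 2 * (m%:R * (m%:R - 1))) <=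
    128 * k%:R ^+ 2 / eps.
  (* From [n <= (m + 1) * k] and [4 * k <= n]. *)
  have half : n%:R <= 2 * k%:R * (m%:R - 1) :> R by lra.
  have M_ge : n%:R ^+ 2 <= 4 * k%:R ^+ 2 * (m%:R * (m%:R - 1)) :> R.
    apply: (@le_trans _ _ ((2 * k%:R * (m%:R - 1)) ^+ 2)).
      by rewrite ler_sqr // nnegrE; nra.
    have : 0 <= k%:R ^+ 2 * (m%:R - 1) :> R by rewrite mulr_ge0 ?sqr_ge0 //; lra.
    lra.
  have M_gt0 : 0 < m%:R * (m%:R - 1) :> R by rewrite mulr_gt0 //; lra.
  rewrite ler_pdivrMr; last exact: mulr_gt0.
  have -> : 128 * k%:R ^+ 2 / eps * (eps / 2 * (m%:R * (m%:R - 1))) =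
    16 * (4 * k%:R ^+ 2 * (m%:R * (m%:R - 1))) by field; rewrite gt_eqF.
  by rewrite ler_wpM2l.
have tail : 1 + 128 * k%:R ^+ 2 / eps <= eps / 2 * n%:R.
  move: nCR; rewrite /C ler_pdivrMr //; lra.
lra.
Qed.
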